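(* Let $\mathcal{X}$ be an LFCM space and let $C^0$ and $C^1$ be coarse $\mathcal{X}$-modules. Suppose there exists an invertible approximable operator $t\colon C^0\to C^1$. Then, for $\kappa=1$ and for any infinite cardinal $\kappa$, the $\kappa$-domains of $C^0$ and $C^1$ are asymptotically equivalent: $\operatorname{dom}_\kappa(C^0)\asymp\operatorname{dom}_\kappa(C^1)$.
   Context: A coarse structure on a set $X$ is a family $\mathcal{E}^X$ of subsets of $X\times X$ (entourages) containing the diagonal and closed under subsets, finite unions, transposes and compositions. $A\subset X$ is $E$-bounded if $A\times A\subset E$, bounded if it is $E$-bounded for some entourage $E$. With $E[A]=\{x\mid\exists a\in A:(x,a)\in E\}$, $A\prec B$ means $A\subset E[B]$ for some $E\in\mathcal{E}^X$; $A\asymp B$ means $A\prec B$ and $B\prec A$. A locally finite coarse measurable (LFCM) space is a triple $\mathcal{X}=(X,\mathcal{E}^X,\mathfrak{A}^X)$ with $(X,\mathcal{E}^X)$ a coarse space and $\mathfrak{A}^X$ a Boolean algebra of subsets of $X$ (the measurable sets) for which there is a partition $\{A_i\}_{i\in I}$ of $X$ (a discrete partition) by measurable sets such that every bounded set meets finitely many $A_i$, all $A_i$ are $E$-bounded for a common entourage $E$, and $B\in\mathfrak{A}^X$ iff $B\cap A_i\in\mathfrak{A}^X$ for all $i$. A discrete partition is fixed and $E^X_{\mathrm{disc}}=\bigsqcup_iA_i\times A_i$. A coarse $\mathcal{X}$-module $C$ is a Hilbert space $H_C$ with a (unital) representation $A\mapsto\mathbb{1}^C_A$ of $\mathfrak{A}^X$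 by projections on $H_C$ such that the span of $\{\mathbb{1}^C_AH_C\mid A\in\mathfrak{A}^X\text{ is }E^X_{\mathrm{disc}}\text{-bounded}\}$ is dense in $H_C$. The support of a bounded operator $t\colon H_C\to H_D$ between $\mathcal{X}$-modules is $\bigcup\{B\times A\mid A,B\in\mathfrak{A}^X\ E^X_{\mathrm{disc}}\text{-bounded},\ \mathbb{1}^D_Bt\mathbb{1}^C_A\ne0\}$; $t$ has controlled propagation if its support is an entourage; $t$ is approximable (written $t\colon C\to D$) if it is a norm limit of controlled propagation operators. Invertible means boundedly invertible. The $\kappa$-domain of $C$ is $\operatorname{dom}_\kappa(C)=\bigcup\{A\in\mathfrak{A}^X\mid A\text{ is }E^X_{\mathrm{disc}}\text{-bounded and }\operatorname{rk}(\mathbb{1}^C_A)\ge\kappa\}$, where the rank of a projection is the Hilbert dimension of its range. *)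

(* Defs.v *)
From HB Require Import structures.
From mathcomp Require Import all_boot all_order all_algebra.
From mathcomp Require Import sesquilinear.
From mathcomp Require Import complex.
From mathcomp Require Import all_classical all_reals all_analysis.

Set Implicit Arguments.
Unset Strict Implicit.
Unset Printing Implicit Defensive.

Import Order.TTheory GRing.Theory Num.Theory.
Import numFieldNormedType.Exports.

Local Open Scope classical_set_scope.
Local Open Scope ring_scope.
Local Open Scope complex_scope.

Record coarse_structure (X : Type) := CoarseStructure {
  entourages : set (set (X * X));
  entourages_diagonal : entourages diagonal;
  entourages_subset : forall E F, entourages E -> F `<=` E -> entourages F;
  entourages_setU : setU_closed entourages;
  entourages_inv : forall E, entourages E -> entourages E^-1%relation;
  entourages_comp :
    forall E F, entourages E -> entourages F -> entourages (E \; F)%relation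
}.

Definition bounded_by (X : Type) (E : set (X * X)) (A : set X) : Prop :=
  A `*` A `<=` E.

Definition thicken (X : Type) (E : set (X * X)) (A : set X) : set X :=
  [set x | exists2 a, A a & E (x, a)].

Section CoarseNotions.
Variables (X : Type) (EX : coarse_structure X).

Definition coarsely_bounded (A : set X) : Prop :=
  exists2 E, entourages EX E & bounded_by E A.

Definition asymp_le (A B : set X) : Prop :=
  exists2 E, entourages EX E & A `<=` thicken E B.

Definition asymp_eq (A B : set X) : Prop := asymp_le A B /\ asymp_le B A.

End CoarseNotions.

(* The fixed discrete partition is part of the data. *)
Record lfcm := LFCM {
  lfcm_space :> Type;
  coarse : coarse_structure lfcm_space;
  meas : set (set lfcm_space);
  meas_set0 : meas set0;
  meas_setU : setU_closed meas;
  meas_setC : setC_closed meas;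
  piece_index : Type;
  piece : piece_index -> set lfcm_space;
  piece_partition : partition setT piece setT;
  piece_meas : forall i, meas (piece i);
  piece_locally_finite : forall B, coarsely_bounded coarse B ->
    finite_set [set i | B `&` piece i !=set0];
  piece_bounded : exists2 E, entourages coarse E & forall i, bounded_by E (piece i);
  measP : forall B, meas B <-> forall i, meas (B `&` piece i)
}.

Definition Edisc (X : lfcm) : set (X * X) :=
  \bigcup_i (@piece X i `*` @piece X i).

Definition disc_meas (X : lfcm) : set (set X) :=
  [set A | meas A /\ bounded_by (@Edisc X) A].

Record hilbertSpace (R : realType) := HilbertSpace {
  hilbert_sort :> completeNormedModType R[i];
  inner : {dot hilbert_sort for Num.conj};
  norm_inner : forall x, `|x| ^+ 2 = inner x x
}.

Record bounded_op (R : realType) (H D : hilbertSpace R) := BoundedOp {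
  bop_fun :> {linear H -> D};
  bop_bounded : exists M : R[i], forall x, `|bop_fun x| <= M * `|x|
}.

(* Norms take (real) values in R[i], hence the real part. *)
Definition op_norm (R : realType) (H D : hilbertSpace R) (f : H -> D) : R :=
  sup [set complex.Re `|f x| | x in [set x | `|x| <= 1]].

Definition invertible (R : realType) (H D : hilbertSpace R)
    (t : bounded_op H D) : Prop :=
  exists s : bounded_op D H, cancel t s /\ cancel s t.

Definition projection (R : realType) (H : hilbertSpace R)
    (p : bounded_op H H) : Prop :=
  (forall x, p (p x) = p x) /\
  (forall x y, inner H (p x) y = inner H x (p y)).

Definition linear_span (K : pzRingType) (V : lmodType K) (S : set V) : set V :=
  [set v | exists n (c : 'I_n -> K) (s : 'I_n -> V),
    (forall i, S (s i)) /\ v = \sum_(i < n) c i *: s i].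

(* [V] is meant to be a closed subspace; the second clause forces it to be. *)
Definition orthonormal_basis (R : realType) (H : hilbertSpace R)
    (V B : set H) : Prop :=
  (forall e f, B e -> B f -> inner H e f = (e == f)%:R) /\
  closure (linear_span B) = V.

(* A type [kappa] stands for its cardinal. All orthonormal bases of a closed
   subspace are equipotent and at least one exists, so its Hilbert dimension
   is at least [kappa] iff [kappa] embeds into some orthonormal basis. *)
Definition rank_ge (R : realType) (H : hilbertSpace R) (p : bounded_op H H)
    (kappa : Type) : Prop :=
  exists2 B : set H, orthonormal_basis (range p) B & ([set: kappa] #<= B)%card.

(* The values of [ind] outside [meas X] are irrelevant. *)
Record coarse_module (R : realType) (X : lfcm) := CoarseModule {
  module_space :> hilbertSpace R;
  ind : set X -> bounded_op module_space module_space;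
  ind_proj : forall A, meas A -> projection (ind A);
  ind_setT : forall v, ind setT v = v;
  ind_setI : forall A B, meas A -> meas B ->
    forall v, ind (A `&` B) v = ind A (ind B v);
  ind_setU : forall A B, meas A -> meas B -> A `&` B = set0 ->
    forall v, ind (A `|` B) v = ind A v + ind B v;
  ind_dense :
    closure (linear_span (\bigcup_(A in @disc_meas X) range (ind A))) = setT
}.

Section Operators.
Variables (R : realType) (X : lfcm) (C D : coarse_module R X).

Definition op_support (t : bounded_op C D) : set (X * X) :=
  \bigcup_(BA in [set BA : set X * set X |
      [/\ disc_meas BA.1, disc_meas BA.2 &
          exists v, ind D BA.1 (t (ind C BA.2 v)) != 0]])
    (BA.1 `*` BA.2).

Definition controlled_propagation (t : bounded_op C D) : Prop :=
  entourages (coarse X) (op_support t).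

Definition approximable (t : bounded_op C D) : Prop :=
  exists2 s : nat -> bounded_op C D,
    (forall n, controlled_propagation (s n)) &
    (fun n => op_norm (fun x => t x - s n x)) @ \oo --> (0 : R).

End Operators.

Definition kdom (R : realType) (X : lfcm) (C : coarse_module R X)
    (kappa : Type) : set X :=
  \bigcup_(A in [set A | disc_meas A /\ rank_ge (ind C A) kappa]) A.

(* Main.v *)
Require Import Defs.
From mathcomp Require Import all_boot all_order all_algebra.
From mathcomp Require Import all_classical all_reals all_analysis.
From mathcomp Require Import sesquilinear complex ring.

(* Choose s of controlled propagation so close to t that s is bounded below and
   <v, s t^-1 v> <> 0 for v <> 0. Both phi v w = <s v, w> on C0 x C1 and
   phi v w = <v, s w> on C1 x C0 are then bounded sesquilinear forms, nondegenerate
   in v and with controlled support, so one statement about forms gives both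
   inclusions. For A bounded, only finitely many pieces interact with A through
   phi; let G be the union of orthonormal bases of the ranges of their projections
   and E an orthonormal basis of the range of 1_A. By Bessel's inequality each
   g in G satisfies phi e g <> 0 for only countably many e in E, and by
   nondegeneracy every e has such a g. So |E| <= |G| when G is infinite, while a
   finite G forces E to be finite by linear algebra. An infinite cardinal below
   |G| is below the cardinal of one of the finitely many bases forming G. *)

Set Implicit Arguments.
Unset Strict Implicit.
Unset Printing Implicit Defensive.
Import Order.TTheory GRing.Theory Num.Theory.
Import numFieldNormedType.Exports.

Local Open Scope classical_set_scope.
Local Open Scope card_scope.

(** * Cardinal arithmetic *)

(** By choice [r] contains an injective function. Relations spare the later constructions any value
    outside [A], and may relate a point to several images. *)
Lemma card_le_rel T U (A : set T) (B : set U) (r : T -> U -> Prop) :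
  (forall x, A x -> exists2 y, B y & r x y) ->
  (forall x x' y, A x -> A x' -> r x y -> r x' y -> x = x') -> A #<= B.
Proof.
move=> tot inj; have [->|/set0P[x0 Ax0]] := eqVneq A set0; first exact: card_ge0.
(* [y0] is the default value outside [A]. *)
have [y0 _ _] := tot _ Ax0.
have [f fP] : {f : T -> U & forall x, A x -> B (f x) /\ r x (f x)}.
  suff: forall x, {y | A x -> B y /\ r x y}.
    by move=> h; exists (fun x => sval (h x)) => x; case: (h x).
  move=> x; apply: cid; have [Ax|nAx] := pselect (A x); last by exists y0.
  by have [y By rxy] := tot _ Ax; exists y.
have /injfunPex[g] : exists2 f : T -> U, set_fun A B f & set_inj A f.
  exists f; first by move=> x /fP[].
  move=> x x' /set_mem Ax /set_mem Ax' fx; apply: (inj _ _ (f x)) => //.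
    by have [] := fP _ Ax.
  by rewrite fx; have [] := fP _ Ax'.
exact: inj_card_le g.
Qed.

Lemma card_le_exists_rel T U (A : set T) (B : set U) : A #<= B ->
  exists r : T -> U -> Prop, (forall x, A x -> exists2 y, B y & r x y) /\
  (forall x x' y, A x -> A x' -> r x y -> r x' y -> x = x').
Proof.
move=> /card_leP[f]; exists (fun x y => exists2 a : A, x = val a & y = val (f a)).
split=> [x Ax|x x' y _ _ [a -> ->] [b ->] /val_inj/inj-> //]; rewrite ?inE//.
exists (val (f (SigSub (mem_set Ax)))); first exact: set_valP.
by exists (SigSub (mem_set Ax)).
Qed.

Lemma card_leTP T U (A : set U) : [set: T] #<= A ->
  exists2 f : T -> U, forall x, A (f x) & injective f.
Proof.
move=> /card_leP[f]; pose i (x : T) : [set: T] := SigSub (mem_set (I : [set: T] x)).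
exists (fun x => val (f (i x))) => [x|x y /val_inj/inj]; first exact: set_valP.
by rewrite !inE => /(_ I I) [].
Qed.

Lemma card_le_total T U (A : set T) (B : set U) : A #<= B \/ B #<= A.
Proof.
(* A maximal partial injection is total on one side. *)
pose P (G : set (T * U)) := G `<=` A `*` B /\
  forall p q, G p -> G q -> (p.1 = q.1 <-> p.2 = q.2).
have [F FP totF|G [[GAB Ginj] Gmax]] := @Zorn_bigcup _ P.
  split; first by move=> p [G FG Gp]; have [+ _] := FP _ FG; apply.
  move=> p q [G FG Gp] [G' FG' Gq].
  have [GG'|G'G] := totF _ _ FG FG'.
    by have [_] := FP _ FG'; apply => //; exact: GG'.
  by have [_] := FP _ FG; apply => //; exact: G'G.
have [Atot|/existsNP[a /not_implyP[Aa na]]] :=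
    pselect (forall x, A x -> exists y, G (x, y)).
  left; apply: (@card_le_rel _ _ _ _ (fun x y => G (x, y))) => [x /Atot[y Gxy]|].
    by exists y => //; have [] := GAB _ Gxy.
  by move=> x x' y _ _ Gxy Gx'y; have [_] := Ginj _ _ Gxy Gx'y; exact.
right; apply: (@card_le_rel _ _ _ _ (fun y x => G (x, y))) => [y By|].
  apply: contrapT => nb; apply: (Gmax (G `|` [set (a, y)])).
    split=> [p Gp|/(_ (a, y))]; first by left.
    by move=> h; apply: na; exists y; apply: h; right.
  split=> [p [/GAB//|->//]|p q].
  case=> [Gp|->]; case=> [Gq|->] //=; first exact: Ginj.
    split=> e; first by case: na; exists p.2; rewrite -e -surjective_pairing.
    by case: nb; exists p.1; [have [] := GAB _ Gp|rewrite -e -surjective_pairing].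
  split=> e; first by case: na; exists q.2; rewrite e -surjective_pairing.
  by case: nb; exists q.1; [have [] := GAB _ Gq|rewrite e -surjective_pairing].
by move=> y y' x _ _ Gxy Gxy'; have [+ _] := Ginj _ _ Gxy Gxy'; exact.
Qed.

Lemma card_le_setX T T' U U' (A : set T) (B : set U) (A' : set T') (B' : set U') :
  A #<= A' -> B #<= B' -> A `*` B #<= A' `*` B'.
Proof.
move=> /card_le_exists_rel[r [rt ri]] /card_le_exists_rel[s [st si]].
apply: (@card_le_rel _ _ _ _ (fun p q => r p.1 q.1 /\ s p.2 q.2)).
  move=> [x y] [/= /rt[x' Ax' rx] /st[y' By' sy]].
  by exists (x', y').
move=> [x y] [x' y'] [a b] [/= Ax By] [/= Ax' By'] [r1 s1] [r2 s2].
by rewrite (ri _ _ _ Ax Ax' r1 r2) (si _ _ _ By By' s1 s2).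
Qed.

Lemma card_le_setX_nat T U (A : set T) (B : set U) : countable B ->
  (A `*` B) `*` [set: nat] #<= A `*` [set: nat].
Proof.
move=> cB; apply: (@card_le_trans _ _ _ (A `*` (B `*` [set: nat]))).
  apply: (@card_le_rel _ _ _ _ (fun p q => q = (p.1.1, (p.1.2, p.2)))).
    by move=> [[x y] n] [[/= Ax By] _]; exists (x, (y, n)).
  by move=> [[x y] n] [[x' y'] n'] q _ _ -> [-> -> ->].
by apply: card_le_setX => //; exact: countableX.
Qed.

(** A point of [F i] goes to [i] paired with its image under an injection chosen for [F i]. A point
    lying in several [F i] is related to several pairs, which is harmless. *)
Lemma card_le_bigcup I T U (D : set I) (F : I -> set T) (B : set U) :
  (forall i, D i -> F i #<= B) -> \bigcup_(i in D) F i #<= D `*` B.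
Proof.
move=> FB.
have r i : exists r : T -> U -> Prop, D i ->
  (forall x, F i x -> exists2 y, B y & r x y) /\
  (forall x x' y, F i x -> F i x' -> r x y -> r x' y -> x = x').
  have [Di|nDi] := pselect (D i); last by exists (fun _ _ => True).
  by have [r rP] := card_le_exists_rel (FB _ Di); exists r.
have {}r i := cid (r i).
apply: (@card_le_rel _ _ _ _ (fun x p => [/\ D p.1, F p.1 x & sval (r p.1) x p.2])).
  move=> x [i Di Fx]; case: (r i) (svalP (r i)) => /= s _.
  have [+ _] := svalP (r i) Di.
  by move=> /(_ _ Fx)[y By rxy]; exists (i, y).
move=> x x' [i y] _ _ [/= Di Fx rx] [_ Fx' rx'].
by have [_] := svalP (r i) Di; apply; [exact: Fx|exact: Fx'|exact: rx|exact: rx'].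
Qed.

Lemma card_le_setX_nat_id T (A : set T) : infinite_set A -> A `*` [set: nat] #<= A.
Proof.
move=> Ainf.
(* A maximal family of injective sequences in A with disjoint ranges covers A up
   to a finite set, so A is equipotent to F x nat. *)
pose P (F : set (nat -> T)) := (forall f n, F f -> A (f n)) /\
  forall f g m n, F f -> F g -> f m = g n -> f = g /\ m = n.
have [F FP totF|F [[FA Finj] Fmax]] := @Zorn_bigcup _ P.
  split=> [f n [G FG Gf]|f g m n [G FG Gf] [G' FG' Gg]].
    by have [+ _] := FP _ FG; apply.
  have [GG'|G'G] := totF _ _ FG FG'.
    by have [_] := FP _ FG'; apply => //; exact: GG'.
  by have [_] := FP _ FG; apply => //; exact: G'G.
pose L := A `\` \bigcup_(f in F) range f.
have Lfin : finite_set L.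
  apply: contrapT => /infiniteP/card_leTP[g gL gi].
  (* An injective sequence in [L] avoids every range of the family, so it could be added to [F]. *)
  have gf f n m : F f -> g n <> f m.
    by move=> Ff e; have [_] := gL n; apply; exists f => //; exists m.
  apply: (Fmax (F `|` [set g])).
    split=> [f|/(_ g)]; first by left.
    by move=> /(_ (or_intror erefl)) Fg; exact: (gf g 0%N 0%N).
  split=> [f n [/FA//|->]|f h m n]; first by have [] := gL n.
  case=> [Ff|->]; case=> [Fh|->]; first exact: Finj.
  - by move=> /esym/gf-/(_ Ff).
  - by move=> /gf-/(_ Fh).
  - by move=> /gi ->.
have AU : A = L `|` \bigcup_(f in F) range f.
  apply/seteqP; split=> x.
    by have [|] := pselect ((\bigcup_(f in F) range f) x); [right|left].
  by case=> [[]//|[f Ff [n _ <-]]]; exact: FA.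
have FN : F `*` [set: nat] #<= A.
  apply: (@card_le_rel _ _ _ _ (fun p x => x = p.1 p.2)) => [[f n] [/= Ff _]|].
    by exists (f n) => //; exact: FA.
  by move=> [f m] [g n] x [/= Ff _] [/= Fg _] -> /Finj[]// -> ->.
have [f0 Ff0] : F !=set0.
  apply: contrapT => /set0P/negP; rewrite negbK => /eqP F0.
  by apply: Ainf; rewrite AU F0 bigcup_set0 setU0.
apply: card_le_trans FN.
(* The third coordinate is 0 on the sequences of [F] and a successor on the remainder [L], so the
   two parts do not collide. *)
have AFN : A #<= (F `*` [set: nat]) `*` [set: nat].
  have /card_le_exists_rel[r [rt ri]] : countable L by exact: finite_set_countable.
  apply: (@card_le_rel _ _ _ _ (fun x p =>
    (p.2 = 0 /\ x = p.1.1 p.1.2) \/ (L x /\ exists2 k, p.2 = k.+1 & r x k))).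
    rewrite AU => x [Lx|[f Ff [n _ <-]]].
      have [k _ rk] := rt _ Lx.
      by exists ((f0, 0), k.+1) => //; right; split => //; exists k.
    by exists ((f, n), 0) => //; left.
  move=> x x' [[f n] k] _ _ /= [[-> ->]|[Lx [k1 ->] rx]] [[] // _ -> //|[Lx' [k2]]] //.
  by move=> [<-] rx'; exact: ri rx rx'.
have NN : countable [set: nat] by exact: countableP.
apply: card_le_trans (card_le_setX AFN (card_lexx _)) _.
by apply: card_le_trans (card_le_setX_nat _ NN) (card_le_setX_nat _ NN).
Qed.

Lemma card_le_bigcup_countable I T (D : set I) (F : I -> set T) :
  infinite_set D -> (forall i, D i -> countable (F i)) ->
  \bigcup_(i in D) F i #<= D.
Proof.
by move=> Dinf /card_le_bigcup FD; exact: card_le_trans (card_le_setX_nat_id Dinf).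
Qed.

(** Cardinals being comparable, some [F j] is largest. It must be infinite, so it absorbs the finite
    factor in the bound [D] x [F j] of the union. *)
Lemma infinite_card_le_bigcup K I T (k : set K) (D : set I) (F : I -> set T) :
  infinite_set k -> finite_set D -> k #<= \bigcup_(i in D) F i ->
  exists2 i, D i & k #<= F i.
Proof.
move=> kinf Dfin kF.
have /(@finite_seqP {classic I})[s Ds] := Dfin.
have [j Dj Fj] : exists2 j, D j & forall i, D i -> F i #<= F j.
  have : D !=set0.
    apply: contrapT => /set0P/negP; rewrite negbK => /eqP D0.
    by apply: kinf; apply: sub_finite_set (finite_set0 K); move: kF;
      rewrite D0 bigcup_set0 card_le0 => /eqP ->.
  rewrite Ds {Ds Dfin kF}; elim: s => [[?]//|x s IHs _].
  have [->|s0] := eqVneq s [::].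
    by exists x => [|i]; rewrite /= inE// => /eqP ->.
  have /IHs[j js jmax] : [set` s] !=set0.
    by case: s s0 {IHs} => // y s _; exists y; rewrite /= mem_head.
  have [xj|jx] := card_le_total (F x) (F j).
    exists j => [|i]; first by rewrite /= inE js orbT.
    by rewrite /= inE => /orP[/eqP ->//|/jmax].
  exists x => [|i]; first by rewrite /= mem_head.
  by rewrite /= inE => /orP[/eqP ->//|/jmax]; move/card_le_trans; apply.
exists j => //; apply: (card_le_trans kF).
have Finf : infinite_set (F j).
  move=> Ffin; apply: kinf; apply: (card_le_finite kF).
  by apply: bigcup_finite => // i /Fj /card_le_finite; apply.
apply: card_le_trans (card_le_setX_nat_id Finf).
apply: card_le_trans (card_le_bigcup Fj) _.
apply: card_le_trans (card_le_setX (finite_set_countable Dfin) (card_lexx _)) _.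
apply: (@card_le_rel _ _ _ _ (fun p q => p = (q.2, q.1))) => [[n x] [_ /= Fx]|].
  by exists (x, n).
by move=> p p' q _ _ -> ->.
Qed.

Local Open Scope ring_scope.

(** * Hilbert spaces *)

Section Complex.
Variable R : realType.
Implicit Types a b : complex R.

(** A positive element of [complex R] is real, so the Archimedean property of [R] applies. *)
Lemma invS_lt_complex a : 0 < a -> exists n : nat, n.+1%:R^-1 < a.
Proof.
move=> a0; have aR := RRe_real (gtr0_real a0).
have ra0 : 0 < complex.Re a by rewrite -ltcR aR.
have [n] := ltr_add_invr ra0.
rewrite add0r => h; exists n.
by rewrite -aR -(rmorph_nat (real_complex R)) -fmorphV ltcR.
Qed.

End Complex.

Section Inner.
Variables (R : realType) (H : hilbertSpace R).
Implicit Types (x y z : H) (a : complex R).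

Lemma innerC x y : inner H x y = (inner H y x)^*.
Proof. by rewrite hermC expr0 mul1r. Qed.

Lemma innerBr x y z : inner H x (y - z) = inner H x y - inner H x z.
Proof. exact: linearBr. Qed.

Lemma norm_subE x y :
  `|x - y| ^+ 2 = `|x| ^+ 2 + `|y| ^+ 2 - (inner H x y + (inner H x y)^*).
Proof. by rewrite !norm_inner dnormB. Qed.

Lemma norm_subZ x y a :
  `|x - a *: y| ^+ 2 =
  `|x| ^+ 2 - (a^* * inner H x y + a * (inner H x y)^*) + `|a| ^+ 2 * `|y| ^+ 2.
Proof.
rewrite norm_subE linearZr_LR normrZ/= rmorphM/= conjCK exprMn.
by ring.
Qed.

(** Pythagoras for removing the component along [y]. It yields Cauchy-Schwarz and, later,
    orthogonality to a subspace at minimal distance. *)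
Lemma norm_sub_proj x y : y != 0 ->
  `|x - (inner H x y / `|y| ^+ 2) *: y| ^+ 2 =
  `|x| ^+ 2 - `|inner H x y| ^+ 2 / `|y| ^+ 2.
Proof.
move=> y0.
have yR : (`|y| ^+ 2)^-1^* = (`|y| ^+ 2)^-1.
  by apply/CrealP; rewrite realE invr_ge0 exprn_ge0.
rewrite norm_subZ rmorphM/= yR normrM exprMn.
rewrite [`|_^-1|]ger0_norm ?invr_ge0 ?exprn_ge0// normCK.
by field; rewrite normr_eq0.
Qed.

Lemma cauchy_schwarz x y : `|inner H x y| <= `|x| * `|y|.
Proof.
have [->|y0] := eqVneq y 0; first by rewrite linear0r !normr0 mulr0.
rewrite -ler_sqr ?nnegrE ?mulr_ge0// exprMn.
have N0 : 0 < `|y| ^+ 2 by rewrite exprn_gt0 ?normr_gt0.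
by rewrite -ler_pdivrMr// -subr_ge0 -norm_sub_proj// exprn_ge0.
Qed.

Lemma parallelogram x y :
  `|x + y| ^+ 2 + `|x - y| ^+ 2 = 2 * `|x| ^+ 2 + 2 * `|y| ^+ 2.
Proof. by rewrite !norm_inner dnormB dnormD; ring. Qed.

End Inner.

Section LinearSpan.
Variables (K : pzRingType) (V : lmodType K).
Implicit Types (S N : set V).

Definition vector_subspace N := N 0 /\ forall c x y, N x -> N y -> N (c *: x + y).

Lemma subspace_linear_span S : vector_subspace (linear_span S).
Proof.
split; first by exists 0%N, (fun=> 0), (fun=> 0); split => [[]//|]; rewrite big_ord0.
move=> c _ _ [m [a [s [sS ->]]]] [n [b [t [tS ->]]]].
exists (m + n)%N.
exists (fun i => match fintype.split i with inl j => c * a j | inr j => b j end).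
exists (fun i => match fintype.split i with inl j => s j | inr j => t j end).
split=> [i|]; first by case: (fintype.split i).
rewrite big_split_ord/= scaler_sumr; congr (_ + _); apply: eq_bigr => i _.
  by rewrite (unsplitK (inl _ i)) scalerA.
by rewrite (unsplitK (inr _ i)).
Qed.

Lemma linear_span_sub S N : vector_subspace N -> S `<=` N -> linear_span S `<=` N.
Proof.
move=> [N0 NZ] SN _ [n [c [s [sS ->]]]]; apply: (big_ind N) => //.
  by move=> x y Nx Ny; rewrite -[x]scale1r; exact: NZ.
by move=> i _; rewrite -[_ *: _]addr0; apply: NZ => //; exact: SN.
Qed.

Lemma sub_linear_span S : S `<=` linear_span S.
Proof.
move=> x Sx; exists 1%N, (fun=> 1), (fun=> x); split=> //.
by rewrite big_ord1 scale1r.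
Qed.

End LinearSpan.

Section Closure.
Variables (R : realType) (H : hilbertSpace R).
Implicit Types (x y z : H) (S : set H).

Lemma closure_dist S x : closure S x <->
  forall e : complex R, 0 < e -> exists2 y, S y & `|x - y| < e.
Proof.
split=> [Sx e e0|Sx B].
  have [y [Sy xy]] := Sx _ (nbhsx_ballx x e e0).
  by exists y => //; move: xy; rewrite -ball_normE.
rewrite -nbhs_ballE => -[e /= e0 xB]; have [y Sy xy] := Sx e e0.
by exists y; split=> //; apply: xB; rewrite -ball_normE.
Qed.

Lemma vanish_closure (V : normedZmodType (complex R)) (g : H -> V)
    (M : complex R) S :
  (forall x y, `|g x - g y| <= M * `|x - y|) ->
  (forall x, S x -> g x = 0) -> forall x, closure S x -> g x = 0.
Proof.
move=> gM gS x /closure_dist Sx; apply/eqP; rewrite -normr_le0.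
have N0 : 0 < `|M| + 1 by rewrite ltr_wpDl.
apply/ler_addgt0Pl => e e0; rewrite addr0.
have [|y Sy xy] := Sx (e / (`|M| + 1)); first by rewrite divr_gt0.
have := gM x y; rewrite (gS _ Sy) subr0 => /le_trans; apply.
(* [M] is an arbitrary complex number, but the Lipschitz bound forces it to be real unless [x] and
   [y] coincide. *)
have : M * `|x - y| <= (`|M| + 1) * `|x - y|.
  have [xy0|xy0] := eqVneq `|x - y| 0; first by rewrite xy0 !mulr0.
  have : M \is Num.real.
    have := le_trans (normr_ge0 _) (gM x y).
    by rewrite pmulr_lge0 ?lt_def ?xy0//=; exact: ger0_real.
  by move=> MR; rewrite ler_wpM2r// (le_trans (real_ler_norm MR))// lerDl.
by move/le_trans; apply; rewrite mulrC -ler_pdivlMr// ltW.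
Qed.

(** Linearity is asked only of the zero set, so that conjugate-linear maps such as [phi v] are
    covered. *)
Lemma vanish_closure_span (V : normedZmodType (complex R)) (g : H -> V)
    (M : complex R) S :
  (forall x y, `|g x - g y| <= M * `|x - y|) ->
  vector_subspace [set x | g x = 0] ->
  (forall x, S x -> g x = 0) -> forall x, closure (linear_span S) x -> g x = 0.
Proof.
move=> gM gs gS; apply: vanish_closure gM _.
exact: linear_span_sub gs gS.
Qed.

End Closure.

Section Bounded.
Variables (R : realType) (H D : hilbertSpace R).

Lemma bop_bound (f : bounded_op H D) :
  exists M : complex R, 0 <= M /\ forall x, `|f x| <= M * `|x|.
Proof.
have [M fM] := bop_bounded f; exists `|M|; split=> // x.
apply: le_trans (fM x) _; rewrite -[in leRHS](normr_id x) -normrM.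
by rewrite (ger0_norm (le_trans (normr_ge0 _) (fM x))).
Qed.

(** Rescale [x] to norm 1. The bounds of [t] and [s] ensure that the supremum in [op_norm] is over a
    bounded set. *)
Lemma op_norm_ub (t s : bounded_op H D) x :
  `|t x - s x| <= (op_norm (fun x => t x - s x))%:C%C * `|x|.
Proof.
have [Mt [Mt0 tM]] := bop_bound t; have [Ms [Ms0 sM]] := bop_bound s.
have tsM y : `|t y - s y| <= (Mt + Ms) * `|y|.
  by rewrite (le_trans (ler_normB _ _))// mulrDl lerD.
have [->|x0] := eqVneq x 0; first by rewrite !linear0 addr0 !normr0 mulr0.
have nx0 : 0 < `|x| by rewrite normr_gt0.
have -> : t x - s x = `|x| *: (t (`|x|^-1 *: x) - s (`|x|^-1 *: x)).
  by rewrite !linearZ/= -scalerDr scalerA divff ?gt_eqF// scale1r.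
rewrite normrZ normr_id mulrC ler_pM2r//.
have n1 : `| `|x|^-1 *: x| <= 1.
  by rewrite normrZ ger0_norm ?invr_ge0// mulVf ?gt_eqF.
rewrite -(RRe_real (normr_real _)) lecR; apply: sup_ubound; last by exists (`|x|^-1 *: x).
exists (complex.Re (Mt + Ms)) => _ [y /= y1 <-].
rewrite -lecR !RRe_real ?ger0_real ?addr_ge0//.
by rewrite (le_trans (tsM y))// ler_piMr ?addr_ge0.
Qed.

End Bounded.

Section Orthonormal.
Variables (R : realType) (H : hilbertSpace R).

Definition orthonormal_set (B : set H) :=
  forall e f, B e -> B f -> inner H e f = (e == f)%:R.

Lemma inner_orthonormal_sum B n (e : 'I_n -> H) (c : 'I_n -> complex R) j :
  orthonormal_set B -> (forall i, B (e i)) -> injective e ->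
  inner H (\sum_i c i *: e i) (e j) = c j.
Proof.
move=> oB eB ei; rewrite linear_sumlz (bigD1 j)//= linearZl_LR/= oB// eqxx mulr1.
rewrite big1 ?addr0// => i ij.
by rewrite linearZl_LR/= oB// (inj_eq ei) (negbTE ij) mulr0.
Qed.

Lemma norm_orthonormal_sum B n (e : 'I_n -> H) (c : 'I_n -> complex R) :
  orthonormal_set B -> (forall i, B (e i)) -> injective e ->
  `|\sum_i c i *: e i| ^+ 2 = \sum_i `|c i| ^+ 2.
Proof.
move=> oB eB ei; rewrite norm_inner linear_sumr; apply: eq_bigr => i _.
by rewrite linearZr_LR/= (inner_orthonormal_sum _ _ oB)// mulrC normCK.
Qed.

(** [v - z] is the limit of a sequence in [M] minimizing the distance to [v]; it lies in the
    closure, as [M] need not be closed. *)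
Lemma orthogonal_projection (M : set H) (v : H) : vector_subspace M ->
  exists z, closure M (v - z) /\ forall m, M m -> inner H z m = 0.
Proof.
move=> [M0 MZ].
pose D := [set complex.Re (`|v - m| ^+ 2) | m in M].
have ReE m : (complex.Re (`|v - m| ^+ 2))%:C%C = `|v - m| ^+ 2.
  by apply: RRe_real; rewrite ger0_real// exprn_ge0.
have D0 : has_inf D.
  split; first by exists (complex.Re (`|v - 0| ^+ 2)); exists 0.
  by exists 0 => _ [m _ <-]; rewrite -lecR ReE exprn_ge0.
pose d : complex R := (inf D)%:C%C.
have dM m : M m -> d <= `|v - m| ^+ 2.
  move=> Mm; rewrite -ReE lecR; apply: ge_inf; last by exists m.
  by case: D0.
have /choice[u uP] n : exists u, M u /\ `|v - u| ^+ 2 <= d + n.+1%:R^-1.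
  have [||_ [m Mm <-] h] := @inf_adherent _ D n.+1%:R^-1.
  - by rewrite invr_gt0.
  - by [].
  exists m; split=> //; rewrite -ReE -(rmorph_nat (real_complex R)) -fmorphV.
  by rewrite -rmorphD lecR ltW.
have uM n : M (u n) by case: (uP n).
have ud n : `|v - u n| ^+ 2 <= d + n.+1%:R^-1 by case: (uP n).
(* A minimizing sequence is Cauchy by the parallelogram law. *)
have uu m n : `|u m - u n| ^+ 2 <= 2 * m.+1%:R^-1 + 2 * n.+1%:R^-1.
  have := parallelogram (v - u n) (v - u m).
  have -> : v - u n - (v - u m) = u m - u n.
    by rewrite opprB addrC addrA subrK.
  (* The midpoint of [u n] and [u m] is in [M], hence at squared distance at least [d] from [v]. *)
  have -> : v - u n + (v - u m) = 2 *: (v - (2^-1 *: u n + 2^-1 *: u m)).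
    rewrite scalerBr scalerDr !scalerA divff ?pnatr_eq0// !scale1r scaler_nat mulr2n.
    by rewrite addrACA opprD.
  rewrite normrZ exprMn normr_nat => pE.
  have := dM (2^-1 *: u n + 2^-1 *: u m) (MZ _ _ _ (uM n) _).
  have MM : M (2^-1 *: u m) by rewrite -[_ *: _]addr0; exact: MZ.
  move=> /(_ MM); have := ud n; have := ud m.
  move: pE; set X := `|_ - (_ + _)| ^+ 2; set Y := `|_| ^+ 2.
  set A := `|_| ^+ 2; set B := `|_| ^+ 2; set a := m.+1%:R^-1; set b := n.+1%:R^-1.
  move=> pE hA hB hX; rewrite -subr_ge0.
  have -> : 2 * a + 2 * b - Y = 2 * (d + a - B) + 2 * (d + b - A) + 4 * (X - d).
    have -> : Y = 2 * A + 2 * B - 2 ^+ 2 * X by rewrite -pE addrC addKr.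
    by ring.
  by rewrite !addr_ge0// mulr_ge0// subr_ge0.
have uC : cvgn u.
  apply: cauchy_cvg; apply/cauchy_ballP => e e0.
  have /invS_lt_complex[N hN] : 0 < e ^+ 2 / 4 by rewrite divr_gt0// exprn_gt0.
  have uN n : (N <= n)%N -> n.+1%:R^-1 <= N.+1%:R^-1 :> complex R.
    by move=> Nn; rewrite lef_pV2 ?posrE ?ltr0n// ler_nat.
  have NN : \forall x \near u @ \oo, [set u n | n in [set n | (N <= n)%N]] x.
    by exists N => // n /= Nn; exists n.
  exists ([set u n | n in [set n | (N <= n)%N]],
    [set u n | n in [set n | (N <= n)%N]]) => //.
  move=> [_ _] [/= [m /= Nm <-] [n /= Nn <-]].
  rewrite -ball_normE/= -ltr_sqr ?nnegrE ?(ltW e0)//.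
  apply: le_lt_trans (uu m n) _; rewrite -mulrDr.
  rewrite ltr_pdivlMr// in hN; apply: le_lt_trans hN.
  rewrite [leRHS](_ : _ = 2 * (N.+1%:R^-1 + N.+1%:R^-1)); last by ring.
  by rewrite ler_pM2l// lerD// uN.
pose l := lim (u @ \oo).
have ul e : 0 < e -> \forall n \near \oo, `|l - u n| < e.
  by move=> e0; move/cvgrPdist_lt : uC; apply.
exists (v - l); split.
  rewrite subKr; apply/closure_dist => e e0.
  have [n _ /(_ n (leqnn n)) h] := ul e e0.
  by exists (u n).
move=> m Mm; have [->|m0] := eqVneq m 0; first by rewrite linear0r.
have nm0 : 0 < `|m| by rewrite normr_gt0.
apply/eqP; rewrite -normr_le0; apply/ler_addgt0Pl => e e0; rewrite addr0.
have e2 : 0 < e / 2 by rewrite divr_gt0.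
have /invS_lt_complex[N hN] : 0 < (e / 2) ^+ 2 / `|m| ^+ 2.
  by rewrite divr_gt0 ?exprn_gt0.
have [N' _ hN'] := ul _ (divr_gt0 e2 nm0).
pose n := maxn N N'.
(* Each term contributes at most e/2: the second by Cauchy-Schwarz, the first by minimality of
   [d]. *)
have -> : v - l = (v - u n) - (l - u n) by rewrite opprB addrA subrK.
rewrite linearBl (le_trans (ler_normB _ _))// [leRHS](splitr e) lerD//; last first.
  rewrite (le_trans (cauchy_schwarz _ _))// -ler_pdivlMr// ltW//.
  exact: hN' (leq_maxr _ _).
rewrite -ler_sqr ?nnegrE ?normr_ge0 ?(ltW e2)//.
set p := inner H (v - u n) m.
(* Moving [u n] by this multiple of [m] lowers the squared distance by |p|^2/|m|^2, but it exceeded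
   [d] by at most 1/(n+1). *)
have /dM : M ((p / `|m| ^+ 2) *: m + u n) by exact: MZ.
rewrite opprD addrCA addrC norm_sub_proj// -/p => h.
have : `|p| ^+ 2 / `|m| ^+ 2 <= n.+1%:R^-1.
  rewrite -(lerD2l d); apply: le_trans (ud n).
  by rewrite -lerBrDr.
have nN : n.+1%:R^-1 <= N.+1%:R^-1 :> complex R.
  by rewrite lef_pV2 ?posrE ?ltr0n// ler_nat ltnS leq_maxl.
move=> /le_trans/(_ nN)/le_trans/(_ (ltW hN)).
by rewrite ler_pM2r// invr_gt0 exprn_gt0.
Qed.

(** Take a maximal orthonormal subset of the range. If its closed span missed a vector [v] of the
    range, the part of [v] orthogonal to that span, normalized, could be added. *)
Lemma orthonormal_basis_exists (p : bounded_op H H) : projection p ->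
  exists B, orthonormal_basis (range p) B.
Proof.
move=> [pp psym].
have rp x : range p x <-> p x = x.
  by split=> [[y _ <-]|<-]; [exact: pp|exists x].
have [F FP totF|B [[Bp oB] Bmax]] :=
    @Zorn_bigcup _ [set B | B `<=` range p /\ orthonormal_set B].
  split=> [x [G FG Gx]|e f [G FG Ge] [G' FG' Gf]].
    by have [+ _] := FP _ FG; apply.
  have [GG'|G'G] := totF _ _ FG FG'.
    by have [_] := FP _ FG'; apply => //; exact: GG'.
  by have [_] := FP _ FG; apply => //; exact: G'G.
(* The range of [p] is closed, being the zero set of the Lipschitz map [p x - x]. *)
have spanp : closure (linear_span B) `<=` range p.
  have [K [K0 pK]] := bop_bound p.
  move=> v Bv; apply/rp/eqP; rewrite -subr_eq0; apply/eqP; move: v Bv.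
  apply: (@vanish_closure_span _ _ _ (fun x => p x - x) (K + 1)).
  - move=> x y; have -> : p x - x - (p y - y) = p (x - y) - (x - y).
      by rewrite (linearB p) !opprD !opprK addrACA.
    by rewrite (le_trans (ler_normB _ _))// mulrDl mul1r lerD.
  - split=> [|c x y /= /eqP]; first by rewrite /= linear0 subrr.
    rewrite subr_eq0 => /eqP px /eqP; rewrite subr_eq0 => /eqP py.
    by rewrite linearP px py subrr.
  - by move=> x /Bp/rp ->; rewrite subrr.
exists B; split=> //; apply/seteqP; split=> v; first exact: spanp.
move=> vp; have [z [vz zB]] := orthogonal_projection v (subspace_linear_span B).
suff z0 : z = 0 by move: vz; rewrite z0 subr0.
have pz : p z = z.
  have /rp := spanp _ vz; rewrite (linearB p) ((rp _).1 vp).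
  by move=> /addrI/oppr_inj.
apply/eqP; apply: contrapT => /negP z0.
pose e := `|z|^-1 *: z.
have nz : `|z| != 0 by rewrite normr_eq0.
have ee : inner H e e = 1.
  by rewrite -norm_inner normrZ ger0_norm ?invr_ge0// mulVf// expr1n.
have eB f : B f -> inner H e f = 0.
  by move=> Bf; rewrite linearZl_LR/= zB ?mulr0//; exact: sub_linear_span.
have Be : inner H e e <> 0 by rewrite ee; apply/eqP; exact: oner_neq0.
apply: (Bmax (B `|` [set e])).
  split=> [f|/(_ e)]; first by left.
  by move=> /(_ (or_intror erefl))/eB.
split=> [f [/Bp//|->]|f g]; first by apply/rp; rewrite linearZ/= pz.
move=> [Bf|->] [Bg|->]; first exact: oB.
- rewrite innerC eB// conjC0; case: eqVneq => // fe.
  by move: Be; rewrite -[in X in inner H _ X]fe eB.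
- by rewrite eB//; case: eqVneq => // fe; move: Be; rewrite [X in inner H _ X]fe eB.
- by rewrite ee eqxx.
Qed.

End Orthonormal.

(** * Bounded sesquilinear forms *)

Record bounded_form (R : realType) (H K : hilbertSpace R) := BoundedForm {
  form :> H -> K -> complex R;
  form_linearl : forall w, scalar (form^~ w);
  form_linearr : forall v c w w', form v (c *: w + w') = c^* * form v w + form v w';
  form_bounded : exists M, forall v w, `|form v w| <= M * `|v| * `|w|
}.

Section BoundedForm.
Variables (R : realType) (H K : hilbertSpace R) (phi : bounded_form H K).

Lemma form_bound : exists M, 0 <= M /\ forall v w, `|phi v w| <= M * `|v| * `|w|.
Proof.
have [M phiM] := form_bounded phi; exists `|M|; split=> // v w.
apply: le_trans (phiM v w) _.
rewrite -[leLHS]ger0_norm ?(le_trans (normr_ge0 _) (phiM v w))//.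
by rewrite !normrM !normr_id.
Qed.

Lemma form_sumlZ n (c : 'I_n -> complex R) (e : 'I_n -> H) w :
  phi (\sum_i c i *: e i) w = \sum_i c i * phi (e i) w.
Proof.
have phi0 : phi 0 w = 0.
  by have := form_linearl phi w (-1) 0 0; rewrite scaler0 addr0 mulN1r addNr.
elim/big_rec2: _ => // i _ x _ <-; exact: form_linearl.
Qed.

(* Test phi on v = sum of conj(phi e_i w) e_i: then phi v w = |v|^2. *)
Lemma form_bessel (E : set H) n (e : 'I_n -> H) w M : orthonormal_set E ->
  (forall i, E (e i)) -> injective e -> 0 <= M ->
  (forall v, `|phi v w| <= M * `|v|) -> \sum_i `|phi (e i) w| ^+ 2 <= M ^+ 2.
Proof.
move=> oE eE ei M0 phiM; set S := \sum_i _.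
have S0 : 0 <= S by apply: sumr_ge0 => i _; rewrite exprn_ge0.
pose v := \sum_i (phi (e i) w)^* *: e i.
have vS : `|v| ^+ 2 = S.
  rewrite (norm_orthonormal_sum _ oE)//; apply: eq_bigr => i _.
  by rewrite norm_conjC.
have phiv : phi v w = S.
  by rewrite form_sumlZ; apply: eq_bigr => i _; rewrite mulrC normCK.
have := phiM v; rewrite phiv ger0_norm// -ler_sqr ?nnegrE ?mulr_ge0//.
rewrite exprMn vS expr2.
have [->|Sn0] := eqVneq S 0; first by rewrite exprn_ge0.
by rewrite ler_pM2r// lt_def Sn0.
Qed.

(** Bessel's inequality allows only finitely many [e] with |phi e w|^2 at least 1/(n+1), for each
    n. *)
Lemma form_countable (E : set H) w : orthonormal_set E ->
  countable [set e | E e /\ phi e w != 0].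
Proof.
move=> oE; have [M [M0 phiM]] := form_bound.
pose A n := [set e | E e /\ n.+1%:R^-1 <= `|phi e w| ^+ 2].
have -> : [set e | E e /\ phi e w != 0] = \bigcup_n A n.
  apply/seteqP; split=> [e [Ee]|e [n _ [Ee h]]].
    rewrite -normr_gt0 => /(exprn_gt0 2)/invS_lt_complex[n /ltW h].
    by exists n.
  split=> //; apply: contraTneq h => ->.
  by rewrite normr0 expr0n/= -real_ltNge ?invr_gt0// ?real0 ?ger0_real.
apply: bigcup_countable; first exact: countableP.
move=> n _; apply: finite_set_countable; apply: contrapT => /infiniteP/card_leTP[f fA fi].
pose L := (M * `|w|) ^+ 2.
have L0 : 0 <= L by rewrite exprn_ge0// mulr_ge0.
(* So many terms of size 1/(n+1) exceed the Bessel bound [L]. *)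
have [m hm] : exists m : nat, L < m%:R * n.+1%:R^-1.
  have /invS_lt_complex[m] : 0 < (L * n.+1%:R + 1)^-1.
    by rewrite invr_gt0 ltr_wpDl// mulr_ge0.
  rewrite ltf_pV2 ?posrE ?ltr_wpDl ?mulr_ge0// => h.
  exists m.+1; rewrite ltr_pdivlMr ?ltr0n//; apply: lt_trans h.
  by rewrite ltrDl.
have : m%:R * n.+1%:R^-1 <= L.
  apply: (@le_trans _ _ (\sum_(i < m) `|phi (f i) w| ^+ 2)).
    rewrite mulr_natl -[X in _ *+ X]card_ord -sumr_const.
    by apply: ler_sum => i _; case: (fA i).
  apply: (form_bessel oE) => [i|i j /fi/val_inj//||v]; first by case: (fA i).
    by rewrite mulr_ge0.
  by rewrite mulrAC; exact: phiM.
by move=> /(lt_le_trans hm); rewrite ltxx.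
Qed.

(** Pair n+1 vectors of [E] with the n entries of a list for [G]: the matrix has more rows than
    columns, and a nonzero row vector in its left kernel gives a nonzero combination on which [phi]
    vanishes against all of [G]. *)
Lemma form_finite (E : set H) (G : set K) : orthonormal_set E ->
  (forall v, linear_span E v -> v != 0 -> exists2 w, G w & phi v w != 0) ->
  finite_set G -> finite_set E.
Proof.
move=> oE nondeg /finite_seqP[s Gs]; apply: contrapT => /infiniteP/card_leTP[f fE fi].
pose n := size s; pose e (i : 'I_n.+1) := f i.
have ei : injective e by move=> i j /fi/val_inj.
pose A := \matrix_(i < n.+1, j < n) phi (e i) (s`_j).
have [c cA c0] : exists2 c : 'rV_n.+1, c *m A = 0 & c != 0.
  have : kermx A != 0.
    rewrite -mxrank_eq0 mxrank_ker subn_eq0 -ltnNge ltnS.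
    exact: rank_leq_col.
  by move=> /rowV0Pn[c /sub_kermxP cA c0]; exists c.
pose v := \sum_i c 0 i *: e i.
have vE : linear_span E v.
  by exists n.+1, (fun i => c 0 i), e; split=> // i; exact: fE.
have v0 : v != 0.
  apply: contra_neq c0 => v0; apply/rowP => j; rewrite mxE.
  have := inner_orthonormal_sum (fun i => c 0 i) j oE (fun i => fE i) ei.
  by rewrite -/v v0 linear0l => <-.
have [w] := nondeg v vE v0; rewrite Gs /= => /(nthP 0)[j js <-] /negP; apply.
have /rowP/(_ (Ordinal js)) := cA; rewrite !mxE => <-.
by apply/eqP; rewrite form_sumlZ; apply: eq_bigr => i _; rewrite mxE.
Qed.

Lemma form_card (E : set H) (G : set K) : orthonormal_set E ->
  (forall v, linear_span E v -> v != 0 -> exists2 w, G w & phi v w != 0) ->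
  infinite_set E -> E #<= G.
Proof.
move=> oE nondeg Einf.
have Ginf : infinite_set G by move/(form_finite oE nondeg).
apply: card_le_trans (card_le_bigcup_countable Ginf (fun w _ => form_countable w oE)).
apply: subset_card_le => e Ee.
have [||w Gw ew] := nondeg e; last by exists w.
  exact: sub_linear_span.
apply/eqP => e0; have := oE e e Ee Ee.
by rewrite e0 linear0l eqxx => /esym/eqP; rewrite oner_eq0.
Qed.

(** Otherwise [phi v], being continuous, would vanish on the closed span. This turns a witness of
    nondegeneracy into a basis vector, or into a vector of the range of some [ind D A]. *)
Lemma form_closed_span (S : set K) v w : closure (linear_span S) w -> phi v w != 0 ->
  exists2 x, S x & phi v x != 0.
Proof.
move=> Sw vw; apply: contrapT => /forall2NP vS; move/eqP : vw; apply.
have [M [M0 phiM]] := form_bound.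
have phi0 : phi v 0 = 0.
  by have := form_linearr phi v (-1) 0 0; rewrite scaler0 addr0 rmorphN1 mulN1r addNr.
apply: (@vanish_closure_span _ _ _ (phi v) (M * `|v|)) Sw.
- move=> x y; suff -> : phi v x - phi v y = phi v (x - y) by [].
  rewrite -{1}(subrK y x) -{1}[x - y]scale1r form_linearr.
  by rewrite rmorph1 mul1r addrK.
- by split=> // c x y /= x0 y0; rewrite form_linearr x0 y0 mulr0 addr0.
- by move=> x Sx; case: (vS x) => // /negP; rewrite negbK => /eqP.
Qed.

(** The two cases for [kappa] are those in which a lower bound for a finite union passes to one of
    its members: for 1 a single basis vector suffices, for infinite [kappa] it is
    [infinite_card_le_bigcup]. *)
Lemma form_card_transfer I (E : set H) (D : set I) (W F : I -> set K) (kappa : Type) :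
  orthonormal_set E -> finite_set D ->
  (forall i, D i -> orthonormal_basis (W i) (F i)) ->
  (forall v, linear_span E v -> v != 0 ->
    exists i w, [/\ D i, W i w & phi v w != 0]) ->
  [set: kappa] #= [set: unit] \/ infinite_set [set: kappa] ->
  [set: kappa] #<= E -> exists2 i, D i & [set: kappa] #<= F i.
Proof.
move=> oE Dfin FW nondeg kP kE.
have {}nondeg v : linear_span E v -> v != 0 ->
    exists2 w, (\bigcup_(i in D) F i) w & phi v w != 0.
  move=> /nondeg/[apply] -[i [w [Di]]]; have [_ <-] := FW i Di.
  by move=> /form_closed_span/[apply] -[x Fx vx]; exists x => //; exists i.
case: kP => [k1|kinf]; last first.
  apply: infinite_card_le_bigcup => //.
  apply: (card_le_trans kE); apply: (form_card oE nondeg).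
  by move/(card_le_finite kE).
have [e Ee] : E !=set0.
  apply/set0P/negP => /eqP E0; move: kE; rewrite E0 (card_le_eql k1) card_le0.
  by move=> /eqP/seteqP[/(_ tt Logic.I)].
have [||w [i Di Fw] _] := nondeg e.
- exact: sub_linear_span.
- apply/eqP => e0; have := oE e e Ee Ee.
  by rewrite e0 linear0l eqxx => /esym/eqP; rewrite oner_eq0.
exists i => //; rewrite (card_le_eql k1).
apply: (@card_le_rel _ _ _ _ (fun _ x => x = w)) => [_ _|[] []//].
by exists w.
Qed.

End BoundedForm.

(** * Coarse modules *)

Section Lfcm.
Variable X : lfcm.

Lemma entourages_Edisc : entourages (coarse X) (@Edisc X).
Proof.
have [E EE bE] := @piece_bounded X.
by apply: entourages_subset EE _ => xy [i _]; exact: bE.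
Qed.

Lemma piece_cover (x : X) : exists i, @piece X i x.
Proof.
have [+ _ _] := @piece_partition X.
by move=> /seteqP[_ /(_ x Logic.I)[i _ ix]]; exists i.
Qed.

Lemma piece_neq0 i : @piece X i !=set0.
Proof. by have [_ _ /(_ i Logic.I)] := @piece_partition X. Qed.

Lemma piece_inj i j (x : X) : piece i x -> piece j x -> i = j.
Proof.
move=> ix jx; have [_ tX _] := @piece_partition X.
by apply: tX => //; exists x.
Qed.

Lemma disc_meas_piece i : @disc_meas X (piece i).
Proof. by split=> [|xy xyi]; [exact: piece_meas|exists i]. Qed.

(** The point [x] provides a piece when [A] is empty. *)
Lemma disc_meas_sub_piece (x : X) (A : set X) : disc_meas A ->
  exists i, A `<=` piece i.
Proof.
move=> [_ bA]; have [[y Ay]|A0] := pselect (A !=set0); last first.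
  by have [i ix] := piece_cover x; exists i => y Ay; case: A0; exists y.
have [i iy] := piece_cover y; exists i => z Az.
have [j _ [jy jz]] := bA (y, z) (conj Ay Az).
by rewrite (piece_inj iy jy).
Qed.

(** The thickening is bounded: any two of its points are [E]-close to points of [A], and these are
    related by [Edisc]. *)
Lemma finite_pieces_thicken (E : set (X * X)) (A : set X) :
  entourages (coarse X) E -> bounded_by (@Edisc X) A ->
  finite_set [set i | thicken E A `&` piece i !=set0].
Proof.
move=> EE bA; apply: piece_locally_finite.
exists (E^-1 \; (@Edisc X \; E))%relation.
  apply: entourages_comp; first exact: entourages_inv.
  by apply: entourages_comp => //; exact: entourages_Edisc.
move=> [y z] [[a Aa ya] [b Ab zb]].
by exists b => //; exists a => //; exact: bA.
Qed.

End Lfcm.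

Section Modules.
Variables (R : realType) (X : lfcm).
Implicit Types C D : coarse_module R X.

Lemma ind_sub C A B v : meas A -> meas B -> A `<=` B -> ind C B (ind C A v) = ind C A v.
Proof. by move=> mA mB /setIidr AB; rewrite -ind_setI// AB. Qed.

Lemma inner_indl C A v w : meas A -> inner C (ind C A v) w = inner C v (ind C A w).
Proof. by move=> mA; have [_] := ind_proj C mA; exact. Qed.

(** For [x] in a set [A] of rank at least [kappa], the pieces pairing with [A] meet the
    [E]-thickening of [A], so there are finitely many and one of those meeting it has rank at least
    [kappa]. From [x] one reaches it by an [Edisc] step inside [A] and a reversed [E] step. *)
Lemma form_kdom_le C D (phi : bounded_form C D) (E : set (X * X)) (kappa : Type) :
  entourages (coarse X) E ->
  (forall A B v w, disc_meas A -> disc_meas B ->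
    phi (ind C A v) (ind D B w) != 0 -> B `*` A `<=` E) ->
  (forall v, v != 0 -> exists w, phi v w != 0) ->
  [set: kappa] #= [set: unit] \/ infinite_set [set: kappa] ->
  asymp_le (coarse X) (kdom C kappa) (kdom D kappa).
Proof.
move=> EE propE nondeg hkappa.
exists (E^-1 \; @Edisc X)%relation.
  by apply: entourages_comp; [exact: entourages_inv|exact: entourages_Edisc].
move=> x [A [[mA bA] [B [oB BA] kB]] Ax].
have rangeA v : linear_span B v -> ind C A v = v.
  move=> Bv; have : range (ind C A) v by rewrite -BA; exact: subset_closure.
  by move=> [u _ <-]; have [+ _] := ind_proj C mA; exact.
have basis i : exists F, orthonormal_basis (range (ind D (@piece X i))) F.
  by apply: orthonormal_basis_exists; apply: ind_proj; exact: piece_meas.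
have {basis} [F FP] := choice basis.
have [i [y [[a Aa ya] iy]] kF] : exists2 i,
    [set i | thicken E A `&` piece i !=set0] i & [set: kappa] #<= F i.
  apply: (form_card_transfer (phi := phi) oB (finite_pieces_thicken EE bA)
    (fun i _ => FP i) _ hkappa kB) => v Bv v0.
  have [w vw] := nondeg v v0.
  (* Density replaces [w] by a vector living on one set [A'], which is then enlarged to the piece
     containing it. *)
  have Sw : closure (linear_span (\bigcup_(A in @disc_meas X) range (ind D A))) w.
    by rewrite ind_dense.
  have [{vw Sw}w [A' dA' [u _ <-]] vw] := form_closed_span Sw vw.
  have [i A'i] := disc_meas_sub_piece x dA'.
  exists i, (ind D A' u).
  have ui : ind D (piece i) (ind D A' u) = ind D A' u.
    by apply: ind_sub A'i; [case: dA'|exact: piece_meas].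
  split=> //; last by exists (ind D A' u).
  (* Since all of [piece i] x [A] lies in [E], any point of the piece will do. *)
  have [y iy] := piece_neq0 i; exists y; split=> //; exists x => //.
  apply: (propE A (piece i) v (ind D A' u)) => //; first exact: disc_meas_piece.
  by rewrite rangeA// ui.
exists y; first by exists (piece i) => //; split; [exact: disc_meas_piece|exists (F i)].
by exists a => //; exact: bA.
Qed.

End Modules.

(** * Forms given by operators, and the equivalence of the domains *)

Section Operators.
Variables (R : realType).

Section Forms.
Variables (H K : hilbertSpace R) (s : bounded_op H K).

Lemma inner_op_linearl w : scalar (fun v => inner K (s v) w).
Proof. by move=> c x y /=; rewrite linearP linearDl linearZl_LR. Qed.

Lemma inner_op_linearr v c w w' :
  inner K (s v) (c *: w + w') = c^* * inner K (s v) w + inner K (s v) w'.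
Proof. by rewrite linearDr linearZr_LR. Qed.

Lemma inner_op_bounded : exists M, forall v w, `|inner K (s v) w| <= M * `|v| * `|w|.
Proof.
have [M [_ sM]] := bop_bound s; exists M => v w.
by rewrite (le_trans (cauchy_schwarz _ _))// ler_wpM2r.
Qed.

Definition op_form :=
  BoundedForm inner_op_linearl inner_op_linearr inner_op_bounded.

Lemma inner_opr_linearl w : scalar (fun v => inner K v (s w)).
Proof. by move=> c x y /=; rewrite linearDl linearZl_LR. Qed.

Lemma inner_opr_linearr v c w w' :
  inner K v (s (c *: w + w')) = c^* * inner K v (s w) + inner K v (s w').
Proof. by rewrite linearP linearDr linearZr_LR. Qed.

Lemma inner_opr_bounded : exists M, forall v w, `|inner K v (s w)| <= M * `|v| * `|w|.
Proof.
have [M [_ sM]] := bop_bound s; exists M => v w.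
by rewrite (le_trans (cauchy_schwarz _ _))// -mulrA mulrCA ler_wpM2l.
Qed.

(** The form of the adjoint of [s], with the two spaces exchanged. *)
Definition opr_form :=
  BoundedForm inner_opr_linearl inner_opr_linearr inner_opr_bounded.

End Forms.

Lemma approximable_dist (X : lfcm) (C D : coarse_module R X) (t : bounded_op C D)
    (e : complex R) : approximable t -> 0 < e ->
  exists2 s : bounded_op C D, controlled_propagation s &
    forall x, `|t x - s x| <= e * `|x|.
Proof.
move=> [s sC st] e0; have eR := RRe_real (gtr0_real e0).
have re0 : 0 < complex.Re e by rewrite -ltcR eR.
have /cvgrPdist_lt/(_ _ re0)[n _ /(_ n (leqnn n))/=] := st.
rewrite sub0r normrN => sn; exists (s n) => // x.
rewrite (le_trans (op_norm_ub t (s n) x))// ler_wpM2r//.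
by rewrite -eR lecR (le_trans (ler_norm _))// ltW.
Qed.

End Operators.

Theorem theorem2p8 (R : realType) (X : lfcm) (C0 C1 : coarse_module R X)
    (t : bounded_op C0 C1) (t_approx : approximable t) (t_inv : invertible t)
    (kappa : Type)
    (hkappa : [set: kappa] #= [set: unit] \/ infinite_set [set: kappa]) :
  asymp_eq (coarse X) (kdom C0 kappa) (kdom C1 kappa).
Proof.
have [t' [tK t'K]] := t_inv; have [M [M0 t'M]] := bop_bound t'.
(* Closeness 1/(M+1) makes [M] times the error smaller than 1, even for [M] = 0. *)
have M1 : 0 < M + 1 by rewrite ltr_wpDl.
have [s sC ts] : exists2 s : bounded_op C0 C1, controlled_propagation s &
    forall x, `|t x - s x| <= (M + 1)^-1 * `|x|.
  by apply: approximable_dist; rewrite ?invr_gt0.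
have small (V : hilbertSpace R) (v : V) : v != 0 -> (M + 1)^-1 * (M * `|v|) < `|v|.
  rewrite -normr_gt0 => v0; rewrite mulrA gtr_pMl//.
  by rewrite mulrC ltr_pdivrMr// mul1r ltrDl.
split.
- apply: (@form_kdom_le _ _ _ _ (op_form s) (op_support s)) => //.
    move=> A B v w dA dB /= vw xy; exists (B, A) => //=; split=> //.
    exists v; apply: contraNneq vw => sv.
    by rewrite -inner_indl ?sv ?linear0l//; case: dB.
  (* If [s v] = 0 then |v| <= M |t v| = M |t v - s v| <= M/(M+1) |v|, which is absurd. *)
  move=> v v0; exists (s v); rewrite /= dnorm_eq0.
  apply/eqP => sv0.
  have vv : `|v| <= (M + 1)^-1 * (M * `|v|).
    rewrite -{1}(tK v) (le_trans (t'M _))// mulrCA ler_wpM2l//.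
    by have := ts v; rewrite sv0 subr0.
  by have := le_lt_trans vv (small _ v v0); rewrite ltxx.
- apply: (@form_kdom_le _ _ _ _ (opr_form s) (op_support s)^-1%relation) => //.
  + exact: entourages_inv.
  + move=> A B v w dA dB /= vw xy [yB yA]; exists (A, B) => //=; split=> //.
    exists w; apply: contraNneq vw => sv.
    by rewrite inner_indl ?sv ?linear0r//; case: dA.
  (* With w = [t' v], a zero pairing would give |v|^2 = |<v, (t - s) w>| <= M/(M+1) |v|^2. *)
  move=> v v0; exists (t' v); apply/eqP => /= sv0.
  have vv : `|v| ^+ 2 <= `|v| * ((M + 1)^-1 * (M * `|v|)).
    have -> : `|v| ^+ 2 = `|inner C1 v (t (t' v) - s (t' v))|.
      by rewrite innerBr sv0 subr0 t'K -norm_inner ger0_norm ?exprn_ge0.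
    rewrite (le_trans (cauchy_schwarz _ _))// ler_wpM2l// (le_trans (ts _))//.
    by rewrite ler_wpM2l// invr_ge0 ltW.
  move: vv; rewrite expr2 ler_pM2l ?normr_gt0// => /le_lt_trans/(_ (small _ v v0)).
  by rewrite ltxx.
Qed.
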